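(* Fix $i\in\{1,2,3\}$ and constants $\sigma>0,\lambda>0,\rho>0$ with $\rho^{-2}\sigma<1$ and $\rho\le\lambda-2\rho^{-1}\sigma(1-\rho^{-2}\sigma)^{-1}$. (1) If $\Theta_{1,i}$ satisfies $\Theta_{1,i}^{12}\Theta_{1,i}^{21}\le\sigma I$, $\Theta_{1,i}^{21}\Theta_{1,i}^{12}\le\sigma I$, $\Theta_{1,i}^{11}+\Theta_{1,i}^{22}\ge\lambda I$, then the sequence $\{\Theta_{k,i}\}_{k\ge1}$ converges to a block diagonal matrix $\Theta_{\infty,i}=\mathrm{diag}(\Theta_{\infty,i}^{11},\Theta_{\infty,i}^{22})$ with $\Theta_{\infty,i}^{11}+\Theta_{\infty,i}^{22}\ge\rho I$. (2) In the case $i=3$ with $m<n$, if $\Theta_{n,3}$ satisfies these three inequalities, then $\{\Theta_{k,3}\}_{k\ge n}$ converges to a block diagonal matrix $\Theta_{\infty,3}=\mathrm{diag}(\Theta_{\infty,3}^{11},\Theta_{\infty,3}^{22})$ with $\Theta_{\infty,3}^{11}+\Theta_{\infty,3}^{22}\ge\rho I$.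
   Context: Consider $x_{k+1}=Ax_k+Bw_k$ with $x_k\in\mathbb{R}^n$, $w_k\in\mathbb{R}^m$, $(A,B)$ controllable, $\mathrm{rank}(B)=m\le n$, running payoff $\tfrac12x^T\Phi x-\tfrac{\gamma^2}{2}|w|^2$ ($\Phi=\Phi^T>0$), and $k$-step dynamic programming operator $\mathcal{S}_k$ (the $k$-fold composition of $(\mathcal{S}_1\phi)(x)=\sup_w\{\tfrac12x^T\Phi x-\tfrac{\gamma^2}{2}|w|^2+\phi(Ax+Bw)\}$). With basis functions $\psi^1(x,z)=z^Tx$, $\psi^2(x,z)=-\tfrac12(x-z)^TM(x-z)$ ($M=M^T>0$), $\psi^3(x,z)=\delta(x-z)$ ($\delta(0)=0$, $-\infty$ otherwise), set $\mathrm{S}_{k,i}(x,z)=(\mathcal{S}_k\psi^i(\cdot,z))(x)$ and $\mathrm{B}_{k,i}(y,z)=-\sup_x\{\psi^i(x,y)-\mathrm{S}_{k,i}(x,z)\}=-\tfrac12[y;z]^T\Theta_{k,i}[y;z]$, $\Theta_{k,i}$ symmetric with $n\times n$ blocks $\Theta_{k,i}^{jl}$. For $i=3$ and $m<n$, $\mathrm{S}_{k,3}$ is only finite quadratic for $k\ge n$ (it is the optimal payoff over controls steering $x$ to $z$ in $k$ steps), so the sequence starts at $k=n$. The matrices satisfy $\Theta_{k_1+k_2,i}=\Theta_{k_1,i}\circledast\Theta_{k_2,i}$ with $\Omega_1\circledast\Omega_2=\begin{bmatrix}\Omega_1^{11}&0\\0&\Omega_2^{22}\end{bmatrix}-\begin{bmatrix}\Omega_1^{12}\\\Omega_2^{21}\end{bmatrix}(\Omega_1^{22}+\Omega_2^{11})^{-1}\begin{bmatrix}\Omega_1^{21}&\Omega_2^{12}\end{bmatrix}$.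 *)

(* Defs.v *)
From HB Require Import structures.
From mathcomp Require Import all_boot all_order all_algebra.
From mathcomp Require Import all_classical all_reals all_analysis.
Set Implicit Arguments. Unset Strict Implicit. Unset Printing Implicit Defensive.
Import Order.TTheory GRing.Theory Num.Theory.
Import numFieldNormedType.Exports.
Local Open Scope classical_set_scope.
Local Open Scope ring_scope.

Section Defs.
Variable R : realType.

Definition qform (p : nat) (Q : 'M[R]_p) (v : 'cV[R]_p) : R := (v^T *m Q *m v) 0 0.

Definition mxle (p : nat) (P Q : 'M[R]_p) : Prop :=
  forall v : 'cV[R]_p, qform P v <= qform Q v.

Definition posdef (p : nat) (Q : 'M[R]_p) : Prop :=
  Q^T = Q /\ forall v : 'cV[R]_p, v != 0 -> 0 < qform Q v.

Definition controllable (n m : nat) (A : 'M[R]_n) (B : 'M[R]_(n, m)) : Prop :=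
  \rank (\mxrow_(k < n) (A ^+ k *m B)) = n.

Definition DP1 (n m : nat) (A : 'M[R]_n) (B : 'M[R]_(n, m)) (Phi : 'M[R]_n) (gamma : R)
  (phi : 'cV[R]_n -> \bar R) (x : 'cV[R]_n) : \bar R :=
  ereal_sup [set ((1/2 * qform Phi x - gamma ^+ 2 / 2 * qform 1%:M w)%:E
                   + phi (A *m x + B *m w)%R)%E | w in [set: 'cV[R]_m]].

Definition DPk (n m : nat) (A : 'M[R]_n) (B : 'M[R]_(n, m)) (Phi : 'M[R]_n) (gamma : R)
  (k : nat) (phi : 'cV[R]_n -> \bar R) : 'cV[R]_n -> \bar R :=
  iter k (DP1 A B Phi gamma) phi.

Definition psi (n : nat) (M : 'M[R]_n) (i : nat) (x z : 'cV[R]_n) : \bar R :=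
  if i == 1%N then ((z^T *m x) 0 0)%:E
  else if i == 2%N then (- (1/2) * qform M (x - z))%:E
  else (if x == z then 0%E else -oo%E).

Definition Ski (n m : nat) (A : 'M[R]_n) (B : 'M[R]_(n, m)) (Phi : 'M[R]_n) (gamma : R)
  (M : 'M[R]_n) (k i : nat) (x z : 'cV[R]_n) : \bar R :=
  DPk A B Phi gamma k (fun x' => psi M i x' z) x.

Definition Bki (n m : nat) (A : 'M[R]_n) (B : 'M[R]_(n, m)) (Phi : 'M[R]_n) (gamma : R)
  (M : 'M[R]_n) (k i : nat) (y z : 'cV[R]_n) : \bar R :=
  (- ereal_sup [set (psi M i x y - Ski A B Phi gamma M k i x z)%E | x in [set: 'cV[R]_n]])%E.

Definition represents (n m : nat) (A : 'M[R]_n) (B : 'M[R]_(n, m)) (Phi : 'M[R]_n)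
  (gamma : R) (M : 'M[R]_n) (k i : nat) (Theta : 'M[R]_(n + n)) : Prop :=
  Theta^T = Theta /\
  forall y z : 'cV[R]_n,
    Bki A B Phi gamma M k i y z = (- (1/2) * qform Theta (col_mx y z))%:E.

Definition block_hyps (n : nat) (sigma lambda : R) (Theta : 'M[R]_(n + n)) : Prop :=
  [/\ mxle (ursubmx Theta *m dlsubmx Theta) (sigma%:M),
      mxle (dlsubmx Theta *m ursubmx Theta) (sigma%:M)
    & mxle (lambda%:M) (ulsubmx Theta + drsubmx Theta)].

Definition conv_blockdiag (n : nat) (rho : R) (Theta : nat -> 'M[R]_(n + n)) : Prop :=
  exists Thinf : 'M[R]_(n + n),
    [/\ Theta @ \oo --> Thinf,
        ursubmx Thinf = 0, dlsubmx Thinf = 0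
      & mxle (rho%:M) (ulsubmx Thinf + drsubmx Thinf)].

End Defs.

(* Main.v *)
(** Conjugation by [psi] turns the dynamic programming semigroup into a max-plus
    matrix semigroup with kernels [Bki], and evaluating the supremum of a concave
    quadratic gives [Theta (k + p) = Theta k [*] Theta p] as soon as
    [D k = Theta k ^22 + Theta p ^11] is positive definite.  For [i = 1, 2] the
    conjugation is inverted on [S_k(., z)], which is a finite quadratic function:
    if it were infinite at one state, steering to that state in [n] steps would
    make [S_(k+n)] infinite everywhere.

    Let [p] be the first index.  From [D (k + p) = D p - N^T (D k)^-1 N] with
    [N = Theta p ^12], the bound [D k >= rho I] propagates along the multiples of
    [p], the off-diagonal block contracts by [sigma / rho ^ 2] at each step, and the
    total decrease of the (1,1) block is a geometric series; this keeps the sum of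
    the diagonal blocks above [rho I].  The diagonal blocks decrease in [k] (by
    monotonicity of the Riccati recursion when [p = 1], and because resting at the
    origin is free when [i = 3]), so they converge along the whole sequence. *)
Require Import Defs.
From HB Require Import structures.
From mathcomp Require Import all_boot all_order all_algebra.
From mathcomp Require Import all_classical all_reals all_analysis.
From mathcomp Require Import ring lra zify.
Set Implicit Arguments. Unset Strict Implicit. Unset Printing Implicit Defensive.
Import Order.TTheory GRing.Theory Num.Theory.
Import numFieldNormedType.Exports.
Local Open Scope classical_set_scope.
Local Open Scope ring_scope.

(** * Inner products, quadratic forms and inverses of positive definite matrices *)

Section Dot.
Variable R : realType.
Implicit Types n m : nat.

Definition dot {n} (u v : 'cV[R]_n) : R := (u^T *m v) 0 0.

Lemma dotE n (u v : 'cV[R]_n) : dot u v = \sum_i u i 0 * v i 0.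
Proof. by rewrite /dot mxE; apply: eq_bigr => i _; rewrite mxE. Qed.

Lemma dotC n (u v : 'cV[R]_n) : dot u v = dot v u.
Proof. by rewrite !dotE; apply: eq_bigr => i _; rewrite mulrC. Qed.

Lemma dotDr n (u v w : 'cV[R]_n) : dot u (v + w) = dot u v + dot u w.
Proof. by rewrite /dot mulmxDr mxE. Qed.

Lemma dotDl n (u v w : 'cV[R]_n) : dot (u + v) w = dot u w + dot v w.
Proof. by rewrite dotC dotDr !(dotC w). Qed.

Lemma dotNr n (u v : 'cV[R]_n) : dot u (- v) = - dot u v.
Proof. by rewrite /dot mulmxN mxE. Qed.

Lemma dotNl n (u v : 'cV[R]_n) : dot (- u) v = - dot u v.
Proof. by rewrite dotC dotNr dotC. Qed.

Lemma dotZr n (c : R) (u v : 'cV[R]_n) : dot u (c *: v) = c * dot u v.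
Proof. by rewrite /dot -scalemxAr mxE. Qed.

Lemma dotZl n (c : R) (u v : 'cV[R]_n) : dot (c *: u) v = c * dot u v.
Proof. by rewrite dotC dotZr dotC. Qed.

Lemma dot0r n (u : 'cV[R]_n) : dot u 0 = 0.
Proof. by rewrite /dot mulmx0 mxE. Qed.

Lemma dot0l n (u : 'cV[R]_n) : dot 0 u = 0.
Proof. by rewrite dotC dot0r. Qed.

Lemma dot_ge0 n (u : 'cV[R]_n) : 0 <= dot u u.
Proof. by rewrite dotE; apply: sumr_ge0 => i _; exact: sqr_ge0. Qed.

Lemma dot_eq0 n (u : 'cV[R]_n) : dot u u = 0 -> u = 0.
Proof.
rewrite dotE => /eqP; rewrite psumr_eq0 => [/allP u0|i _]; last exact: sqr_ge0.
apply/colP => i; rewrite mxE; apply/eqP.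
by have := u0 i (mem_index_enum i); rewrite -expr2 sqrf_eq0.
Qed.

Lemma dotMl n m (P : 'M[R]_(n, m)) (u : 'cV[R]_m) (v : 'cV[R]_n) :
  dot (P *m u) v = dot u (P^T *m v).
Proof. by rewrite /dot trmx_mul mulmxA. Qed.

Lemma dotMr n m (P : 'M[R]_(n, m)) (u : 'cV[R]_m) (v : 'cV[R]_n) :
  dot v (P *m u) = dot (P^T *m v) u.
Proof. by rewrite dotC dotMl dotC. Qed.

Definition dot_linE := (@dotDl, @dotDr, @dotNl, @dotNr, @dotZl, @dotZr).

Lemma mx_dotE n m (P : 'M[R]_(n, m)) i j :
  P i j = dot (delta_mx i 0) (P *m delta_mx j 0).
Proof. by rewrite /dot trmx_delta mulmxA -rowE -colE !mxE. Qed.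

Lemma dot_mx_ext n m (P Q : 'M[R]_(n, m)) :
  (forall u v, dot u (P *m v) = dot u (Q *m v)) -> P = Q.
Proof. by move=> PQ; apply/matrixP => i j; rewrite mx_dotE PQ -mx_dotE. Qed.

Lemma qformE n (Q : 'M[R]_n) v : qform Q v = dot v (Q *m v).
Proof. by rewrite /qform /dot mulmxA. Qed.

Lemma qform0 n (Q : 'M[R]_n) : qform Q 0 = 0.
Proof. by rewrite qformE mulmx0 dot0r. Qed.

Lemma qformD n (P Q : 'M[R]_n) v : qform (P + Q) v = qform P v + qform Q v.
Proof. by rewrite !qformE mulmxDl dotDr. Qed.

Lemma qformN n (Q : 'M[R]_n) v : qform (- Q) v = - qform Q v.
Proof. by rewrite !qformE mulNmx dotNr. Qed.

Lemma qformZ n (Q : 'M[R]_n) (t : R) v : qform Q (t *: v) = t ^+ 2 * qform Q v.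
Proof. by rewrite !qformE -scalemxAr dotZl dotZr mulrA expr2. Qed.

Lemma qformM n m (P : 'M[R]_(n, m)) (Q : 'M[R]_n) v :
  qform Q (P *m v) = qform (P^T *m Q *m P) v.
Proof. by rewrite !qformE dotMl !mulmxA. Qed.

Lemma qform_scalar n (c : R) (v : 'cV[R]_n) : qform c%:M v = c * dot v v.
Proof. by rewrite qformE mul_scalar_mx dotZr. Qed.

Lemma dot_sym n (Q : 'M[R]_n) u v : Q^T = Q -> dot u (Q *m v) = dot v (Q *m u).
Proof. by move=> Qs; rewrite dotMr Qs dotC. Qed.

Lemma qform_add n (Q : 'M[R]_n) u v : Q^T = Q ->
  qform Q (u + v) = qform Q u + 2 * dot u (Q *m v) + qform Q v.
Proof.
move=> Qs; rewrite !qformE mulmxDr !dotDl !dotDr (dot_sym v u Qs); ring.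
Qed.

Lemma dot_col n m (u v : 'cV[R]_n) (w z : 'cV[R]_m) :
  dot (col_mx u w) (col_mx v z) = dot u v + dot w z.
Proof. by rewrite /dot tr_col_mx mul_row_col mxE. Qed.

Lemma qform_col n (Theta : 'M[R]_(n + n)) y z : Theta^T = Theta ->
  qform Theta (col_mx y z) = qform (ulsubmx Theta) y
    + 2 * dot y (ursubmx Theta *m z) + qform (drsubmx Theta) z.
Proof.
move=> Ts; have Tl : dlsubmx Theta = (ursubmx Theta)^T by rewrite trmx_ursub Ts.
rewrite !qformE -[in LHS](submxK Theta) mul_block_col dot_col !dotDr Tl.
rewrite (dotMr _ y z) trmxK (dotC _ y) dotMr; ring.
Qed.

Lemma posdef_unit n (Q : 'M[R]_n) : posdef Q -> Q \in unitmx.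
Proof.
case=> Qs Qp; rewrite -row_free_unit; apply/inj_row_free => v vQ.
apply/eqP; rewrite -trmx_eq0; apply/negP => /negP /Qp.
by rewrite /qform trmxK vQ mul0mx mxE ltxx.
Qed.

Lemma posdef_ge n (Q : 'M[R]_n) (r : R) : 0 < r -> Q^T = Q ->
  (forall v, r * dot v v <= qform Q v) -> posdef Q.
Proof.
move=> r0 Qs Qr; split=> // v v0; apply: lt_le_trans (Qr v).
apply: mulr_gt0 => //; rewrite lt_def dot_ge0 andbT.
by apply: contra_neq v0 => /dot_eq0.
Qed.

Lemma invmx_sym n (Q : 'M[R]_n) : Q^T = Q -> (invmx Q)^T = invmx Q.
Proof. by move=> Qs; rewrite trmx_inv Qs. Qed.

(* [v = Q u] with [u = invmx Q *m v]; then [|v - r u|^2 >= 0]. *)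
Lemma qform_inv_le n (Q : 'M[R]_n) (r : R) v : 0 < r -> Q^T = Q ->
  (forall v, r * dot v v <= qform Q v) ->
  r * qform (invmx Q) v <= dot v v /\
  r ^+ 2 * dot (invmx Q *m v) (invmx Q *m v) <= dot v v.
Proof.
move=> r0 Qs Qr; have Qu := posdef_unit (posdef_ge r0 Qs Qr).
rewrite qformE; set u := invmx Q *m v.
have Qv : Q *m u = v by rewrite /u mulKVmx.
have h1 := Qr u; rewrite qformE Qv in h1.
have h2 := dot_ge0 (v - r *: u).
rewrite !dot_linE (dotC v u) in h2 *.
have h3 : r * (r * dot u u) <= r * dot u v by rewrite ler_pM2l.
split; nra.
Qed.

Lemma qform_inv_ge0 n (Q : 'M[R]_n) v : posdef Q -> 0 <= qform (invmx Q) v.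
Proof.
move=> Qp; have Qu := posdef_unit Qp; case: Qp => Qs Qp.
have -> : qform (invmx Q) v = qform Q (invmx Q *m v).
  by rewrite qformM invmx_sym // mulVmx // mul1mx.
have [->|/Qp /ltW//] := eqVneq (invmx Q *m v) 0.
by rewrite qform0.
Qed.

(* [u^T Q^-1 u = max_w (2 w^T u - w^T Q w)], which is antitone in [Q]. *)
Lemma qform_inv_anti n (P Q : 'M[R]_n) v : posdef P -> posdef Q ->
  mxle P Q -> qform (invmx Q) v <= qform (invmx P) v.
Proof.
move=> Pp Qp PQ; have Pu := posdef_unit Pp; have Qu := posdef_unit Qp.
have := PQ (invmx Q *m v); set u := invmx Q *m v; set w := invmx P *m v.
have vP : P *m w = v by rewrite /w mulKVmx.
have vQ : Q *m u = v by rewrite /u mulKVmx.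
case: Pp => Ps Pp; case: Qp => Qs Qp.
rewrite (qformE Q) vQ !(qformE (invmx _)) -/u -/w => h.
have : 0 <= qform P (u - w).
  have [->|/Pp /ltW//] := eqVneq (u - w) 0.
  by rewrite qform0.
rewrite qform_add // qformE -[- w]scaleN1r qformZ -scalemxAr vP dotZr (qformE P w) vP.
rewrite (dotC v u) (dotC v w).
rewrite qformE in h; lra.
Qed.

Lemma qform_complete_square n (D : 'M[R]_n) (l y : 'cV[R]_n) : posdef D ->
  qform D y + 2 * dot y l
  = qform D (y + invmx D *m l) - qform (invmx D) l.
Proof.
move=> Dp; have Du := posdef_unit Dp; case: Dp => Ds _.
rewrite qform_add // mulKVmx // (qformE D (_ *m l)) mulKVmx //.
rewrite (qformE (invmx D)) (dotC l); ring.
Qed.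

End Dot.

(** * Suprema of extended-real functions *)

Section Esup.
Variable R : realType.
Local Open Scope ereal_scope.

Definition esup (T : Type) (f : T -> \bar R) : \bar R :=
  ereal_sup [set f x | x in [set: T]].

Lemma esup_ub T (f : T -> \bar R) x : f x <= esup f.
Proof. by apply: ereal_sup_ubound; exists x. Qed.

Lemma esup_le T (f : T -> \bar R) c : (forall x, f x <= c) -> esup f <= c.
Proof. by move=> fc; apply: ge_ereal_sup => _ [x _ <-]. Qed.

Lemma esup_mono T (f g : T -> \bar R) :
  (forall x, f x <= g x) -> esup f <= esup g.
Proof. by move=> fg; apply: esup_le => x; apply: le_trans (fg x) (esup_ub _ _). Qed.

Lemma eq_esup T (f g : T -> \bar R) : f =1 g -> esup f = esup g.
Proof. by move=> /funext ->. Qed.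

Lemma esup_swap T U (f : T -> U -> \bar R) :
  esup (fun x => esup (f x)) = esup (fun y => esup (f^~ y)).
Proof.
by apply/le_anti/andP; split; apply: esup_le => x; apply: esup_le => y;
  apply: le_trans (esup_ub _ y) => /=; apply: (esup_ub (fun _ => _)).
Qed.

Lemma esup_max T (f : T -> \bar R) x : (forall y, f y <= f x) -> esup f = f x.
Proof. by move=> fx; apply/le_anti; rewrite esup_le //= esup_ub. Qed.

Lemma esupDr T (f : T -> \bar R) (c : R) :
  esup (fun x => f x + c%:E) = esup f + c%:E.
Proof.
apply/le_anti/andP; split.
  by apply: esup_le => x; rewrite leeD2rE // esup_ub.
rewrite -leeBrDr //; apply: esup_le => x; rewrite leeBrDr //.
exact: (esup_ub (fun x => f x + c%:E)).
Qed.

Lemma esupDl T (f : T -> \bar R) (c : R) :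
  esup (fun x => c%:E + f x) = c%:E + esup f.
Proof. by rewrite addeC -esupDr; apply: eq_esup => x; rewrite addeC. Qed.

Lemma esup_EFin T (g : T -> R) (x0 : T) : esup (fun x => (g x)%:E) != +oo ->
  exists K : R, forall x, (g x <= K)%R.
Proof.
move=> gy; have gu x := esup_ub (fun x => (g x)%:E) x.
case: esup gy gu => [K|//|] _ gu; last by have := gu x0.
by exists K => x; rewrite -lee_fin.
Qed.

End Esup.

(** * Quadratic functions that are bounded above *)

Section Quadratic.
Variable R : realType.
Implicit Types n m : nat.

Lemma parabola_ub (q d K : R) : (forall t : R, - (1/2) * (t ^+ 2 * q) + t * d <= K) ->
  0 <= q /\ (q = 0 -> d = 0).
Proof.
move=> h; split.
  case: (leP 0 q) => // q0; have K0 := h 0; have q0' : q != 0 by rewrite lt_eqF.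
  (* The linear terms cancel in the average over these two opposite points. What remains is
     [- q * (1 - K / q) ^+ 2 / 2], which exceeds [K] when [q < 0]. *)
  have h1 := h (1 - K / q); have h2 := h (- (1 - K / q)).
  have e : K / q * q = K by rewrite divfK.
  set t := K / q in e h1 h2.
  have : 0 <= t * K by rewrite /t mulrAC; nra.
  nra.
move=> q0; apply/eqP/negP => /negP d0.
by have := h ((K + 1) / d); rewrite q0 divfK //; lra.
Qed.

(** Restriction to the line [t *: w] leaves a parabola bounded above. The conclusions are what a
    maximiser needs: concavity, and solvability of [H *m w0 = l]. *)
Lemma quad_ub n (H : 'M[R]_n) (l : 'cV[R]_n) (K : R) :
  (forall w, - (1/2) * qform H w + dot w l <= K) ->
  (forall w, 0 <= qform H w) /\ (forall w, H *m w = 0 -> dot w l = 0).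
Proof.
move=> h; have hw w : 0 <= qform H w /\ (qform H w = 0 -> dot w l = 0).
  by apply: (@parabola_ub _ _ K) => t; rewrite -qformZ -dotZl.
by split=> w; [case: (hw w)|move=> Hw; apply: (hw w).2; rewrite qformE Hw dot0r].
Qed.

Lemma quad_max n (H : 'M[R]_n) (w0 w : 'cV[R]_n) : H^T = H ->
  (forall w, 0 <= qform H w) ->
  - (1/2) * qform H w + dot w (H *m w0) <= 1/2 * qform H w0.
Proof.
move=> Hs H0; have := H0 (w - w0); rewrite qform_add // -[- w0]scaleN1r qformZ.
rewrite -scalemxAr dotZr; lra.
Qed.

Lemma quad_maxE n (H : 'M[R]_n) (w0 : 'cV[R]_n) :
  - (1/2) * qform H w0 + dot w0 (H *m w0) = 1/2 * qform H w0.
Proof. by rewrite -qformE; lra. Qed.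

(** The range of a symmetric matrix is the orthogonal complement of its kernel. This solves
    first-order conditions in which [H] may be singular. *)
Lemma sub_ker n p (H : 'M[R]_n) (L : 'M[R]_(n, p)) : H^T = H ->
  (forall w u, H *m w = 0 -> dot w (L *m u) = 0) -> exists K, L = H *m K.
Proof.
move=> Hs HL; have /submxP [K LK] : (L^T <= H)%MS.
  rewrite submxE; apply/eqP/trmx_inj; rewrite trmx0 trmx_mul trmxK.
  apply: dot_mx_ext => u v; rewrite mul0mx dot0r -mulmxA dotMr trmxK dotC.
  rewrite dotC; apply: HL; by rewrite mulmxA mulmx_coker mul0mx.
by exists K^T; rewrite -[L]trmxK LK trmx_mul Hs.
Qed.

Definition isquad n (f : 'cV[R]_n -> \bar R) : Prop :=
  exists Q b c, Q^T = Q /\ forall x, f x = (1/2 * qform Q x + dot b x + c)%:E.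

End Quadratic.

(** * Max-plus conjugation with respect to [psi] *)

Section Conjugation.
Variables (R : realType) (n : nat) (M : 'M[R]_n) (i : nat).
Hypothesis Mp : posdef M.
Local Open Scope ereal_scope.
Implicit Types (f : 'cV[R]_n -> \bar R) (x y z : 'cV[R]_n).

(** For [i = 1] this is minus the Fenchel conjugate. Applied to [Ski] in its state argument it gives
    [Bki]. *)
Definition psi_conj f y : \bar R := - esup (fun x => psi M i x y - f x).

Lemma psiC x y : psi M i x y = psi M i y x.
Proof.
rewrite /psi; case: ifP => _; first by rewrite -!/(dot _ _) dotC.
case: ifP => _; last by rewrite eq_sym.
rewrite -[(x - y)%R]opprB -[(- (y - x))%R]scaleN1r qformZ sqrrN expr1n.
by rewrite (mul1r (qform _ _)).
Qed.

(** A common normal form lets [biconj] treat the linear and the quadratic basis together: the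
    coupling [L] is invertible and the Hessian [- N] is the same for all [y]. *)
Lemma psi_real : (i == 1)%N || (i == 2)%N ->
  exists (N L : 'M[R]_n) (r : 'cV[R]_n -> R), [/\ N^T = N, L \in unitmx &
  forall x y, psi M i x y = (- (1/2) * qform N x + dot x (L *m y) + r y)%:E]%R.
Proof.
rewrite /psi; have [_ _|_ /= ->] := eqVneq i 1%N.
  exists 0%R, 1%:M%R, (fun=> 0%R); split; rewrite ?trmx0 ?unitmx1 // => x y.
  by rewrite mul1mx qformE mul0mx dot0r mulr0 add0r addr0 dotC.
exists M, M, (fun y => - (1/2) * qform M y)%R.
split; [by case: Mp|exact: posdef_unit|move=> x y; congr _%:E].
case: Mp => Ms _; rewrite qform_add // -[(- y)%R]scaleN1r qformZ -scalemxAr.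
by rewrite dotZr; field.
Qed.

Lemma esup_delta (g : 'cV[R]_n -> \bar R) y :
  esup (fun x => (if x == y then 0 else -oo) + g x) = g y.
Proof.
rewrite (@esup_max _ _ _ y) ?eqxx ?add0e // => x.
by have [->|_] := eqVneq x y; rewrite ?add0e // addNye leNye.
Qed.

Lemma conj_delta f y : ~~ ((i == 1)%N || (i == 2)%N) -> psi_conj f y = f y.
Proof.
rewrite negb_or /psi_conj => /andP[/negPf i1 /negPf i2].
by rewrite /psi i1 i2 esup_delta oppeK.
Qed.

(* For [i = 1, 2] boundedness of [psi (., y) - f] forces its Hessian to be
   negative semidefinite, so that it is maximal at its critical point, and
   every [x] is the critical point for some [y]. *)
Lemma biconj f : isquad f -> (forall y, psi_conj f y != -oo) ->
  forall x, f x = esup (fun y => psi M i x y + psi_conj f y).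
Proof.
move=> [Q [b [c [Qs fE]]]] fN x.
have [i12|i3] := boolP ((i == 1)%N || (i == 2)%N); last first.
  transitivity (esup (fun y => (if y == x then 0 else -oo) + f y)).
    by rewrite esup_delta.
  apply: eq_esup => y; rewrite conj_delta // /psi; move: i3.
  by rewrite negb_or => /andP[/negPf -> /negPf ->]; rewrite eq_sym.
have [N [L [r [Ns Lu psiE]]]] := psi_real i12.
have E x' y : psi M i x' y - f x' =
    (- (1/2) * qform (N + Q) x' + dot x' (L *m y - b) + (r y - c))%:E%R.
  rewrite psiE fE -EFinB; congr _%:E.
  by rewrite qformD dotDr dotNr (dotC b); ring.
(* Boundedness at [y = 0] decides the sign of the Hessian, which is [- (N + Q)] for every [y]. *)
have [K hK] : exists K : R, forall x',
    (- (1/2) * qform (N + Q) x' + dot x' (L *m 0 - b) + (r 0 - c) <= K)%R.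
  apply: esup_EFin; first exact: 0%R.
  apply: contra (fN 0%R) => /eqP h; rewrite /psi_conj.
  by rewrite (eq_esup (E^~ 0%R)) h.
have [PSD _] : (forall w, 0 <= qform (N + Q) w)%R /\
    (forall w, ((N + Q) *m w)%R = 0%R -> dot w (L *m 0 - b)%R = 0%R).
  by apply: (@quad_ub _ _ _ _ (K - (r 0 - c))%R) => w; have := hK w; lra.
apply/le_anti/andP; split; last first.
  (* This half is the Fenchel-Young inequality. *)
  apply: esup_le => y; rewrite psiE.
  have : psi_conj f y <= - (psi M i x y - f x).
    by rewrite leeN2; exact: (esup_ub (fun x => psi M i x y - f x)).
  rewrite psiE fE -!EFinB -EFinN => h.
  by apply: le_trans (leeD2l _ h) _; rewrite -EFinD lee_fin; lra.
pose y := (invmx L *m ((N + Q) *m x + b))%R.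
have Ly : (L *m y - b = (N + Q) *m x)%R by rewrite /y mulKVmx // addrK.
apply: le_trans (esup_ub (fun y => psi M i x y + psi_conj f y) y).
have -> : psi_conj f y = f x - psi M i x y.
  rewrite /psi_conj (@esup_max _ _ _ x) => [|x'].
    by rewrite psiE fE -!EFinB -EFinN; congr _%:E; ring.
  rewrite !E Ly lee_fin lerD2r quad_maxE.
  by apply: quad_max => //; rewrite linearD /= Ns Qs.
by rewrite psiE fE -EFinB -EFinD lee_fin; lra.
Qed.

End Conjugation.

(** * Dynamic programming: max-plus linearity, reachability, quadratic values *)

Section DynamicProgramming.
Variables (R : realType) (n m : nat) (A : 'M[R]_n) (B : 'M[R]_(n, m)).
Variables (Phi : 'M[R]_n) (gamma : R).
Implicit Types (f : 'cV[R]_n -> \bar R) (x y z : 'cV[R]_n) (w : 'cV[R]_m).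

Local Notation DP1 := (DP1 A B Phi gamma).
Local Notation DPk := (DPk A B Phi gamma).

Let payoff x w : R := 1/2 * qform Phi x - gamma ^+ 2 / 2 * qform 1%:M w.

Lemma DP1_ge f x w : ((payoff x w)%:E + f (A *m x + B *m w)%R <= DP1 f x)%E.
Proof. exact: (esup_ub (fun w => (payoff x w)%:E + f (A *m x + B *m w)%R)%E). Qed.

Lemma DP1_ge_rest f : (f 0%R <= DP1 f 0%R)%E.
Proof.
have := DP1_ge f 0 0; rewrite !mulmx0 addr0 /payoff !qform0 !mulr0 subr0.
by rewrite add0e.
Qed.

Lemma DPk_mono k f g : (forall x, f x <= g x)%E ->
  forall x, (DPk k f x <= DPk k g x)%E.
Proof.
move=> fg; elim: k => [//|k IH] x; apply: esup_mono => w.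
by apply: leeD2l; exact: IH.
Qed.

(** Max-plus linearity: suprema commute, and real constants pass through them. *)
Lemma DPk_esup T k (phi : T -> 'cV[R]_n -> \bar R) (c : T -> R) x :
  DPk k (fun x => esup (fun t => phi t x + (c t)%:E)%E) x
  = esup (fun t => DPk k (phi t) x + (c t)%:E)%E.
Proof.
elim: k x => [//|k IH] x.
transitivity (esup (fun w => esup (fun t =>
    (payoff x w)%:E + (DPk k (phi t) (A *m x + B *m w)%R + (c t)%:E)))%E).
  by apply: eq_esup => w; rewrite esupDl -IH.
rewrite esup_swap; apply: eq_esup => t.
by rewrite -esupDr; apply: eq_esup => w; rewrite addeA.
Qed.

(** Controls are numbered by the time that remains after them, so the induction spends [u k] first.
    The constant [c] collects the payoffs along the path. *)
Lemma DPk_reach k f x (u : nat -> 'cV[R]_m) : exists c : R,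
  (c%:E + f (A ^+ k *m x + \sum_(j < k) A ^+ j *m B *m u j)%R <= DPk k f x)%E.
Proof.
elim: k x => [|k IH] x.
  by exists 0; rewrite add0e big_ord0 addr0 expr0 mul1mx.
have [c hc] := IH (A *m x + B *m u k).
exists (payoff x (u k) + c); apply: le_trans (DP1_ge _ x (u k)).
rewrite EFinD -addeA leeD2lE //; apply: le_trans hc.
rewrite le_eqVlt; apply/orP; left; apply/eqP; congr (_ + f _)%E.
rewrite big_ord_recr /= mulmxDr exprSr -mulmxE !mulmxA -addrA; congr (_ + _).
by rewrite addrC.
Qed.

Lemma controllable_steer x y : controllable A B ->
  exists u : nat -> 'cV[R]_m,
    y = A ^+ n *m x + \sum_(j < n) A ^+ j *m B *m u j.
Proof.
rewrite /controllable; set C := \mxrow_(k < n) _ => rC.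
have : ((y - A ^+ n *m x)^T <= C^T)%MS.
  by apply: submx_full; rewrite /row_full mxrank_tr rC.
move=> /submxP [U /(congr1 trmx)]; rewrite trmx_mul !trmxK => yU.
pose v j := submxcol U^T j.
exists (fun j => if insub j is Some j' then v j' else 0).
rewrite -[LHS](subrK (A ^+ n *m x)) addrC yU -[U^T]submxcolK mul_mxrow_mxcol.
congr (_ + _); apply: eq_bigr => j _; by rewrite /= valK.
Qed.

(** A finite supremum over [w] bounds a quadratic with Hessian [- H], so [H] is positive
    semidefinite, possibly singular, and [l x] lies in its range. The maximiser can then be taken
    affine in [x], which makes the value quadratic. *)
Lemma DP1_quad f : Phi^T = Phi -> isquad f ->
  (forall x, DP1 f x != +oo%E) -> isquad (DP1 f).
Proof.
move=> Ps [Q [b [c [Qs fE]]]] Dfin.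
pose H : 'M[R]_m := (gamma ^+ 2)%:M - B^T *m Q *m B.
have Hs : H^T = H.
  by rewrite /H linearB /= tr_scalar_mx !trmx_mul trmxK Qs mulmxA.
pose rest x := 1/2 * qform Phi x + 1/2 * qform Q (A *m x) + dot b (A *m x) + c.
pose l x := B^T *m (Q *m (A *m x) + b).
have E x w : ((payoff x w)%:E + f (A *m x + B *m w)%R)%E
    = (- (1/2) * qform H w + dot w (l x) + rest x)%:E.
  rewrite fE -EFinD; congr _%:E.
  rewrite qform_add // !dotDr /l /rest /payoff mulmxDr dotDr.
  rewrite /H qformD qformN -qformM !qform_scalar (dot_sym _ _ Qs) dotMl.
  rewrite (dotMr B w b) (dotC _ w).
  by field.
have HK x : (forall w, 0 <= qform H w) /\
    (forall w, H *m w = 0 -> dot w (l x) = 0).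
  have [K hK] : exists K : R, forall w,
      - (1/2) * qform H w + dot w (l x) + rest x <= K.
    apply: esup_EFin; first exact: 0.
    by apply: contra (Dfin x) => /eqP h; rewrite -h; apply/eqP/eq_esup/E.
  by apply: (@quad_ub _ _ _ _ (K - rest x)) => w; have := hK w; lra.
clearbody H; have H0 := (HK 0).1.
have lE x : l x = B^T *m Q *m A *m x + B^T *m b.
  by rewrite /l mulmxDr !mulmxA.
have l0 : l 0 = B^T *m b by rewrite lE mulmx0 add0r.
(* Both [l u] and [l 0] are orthogonal to the kernel of [H]; hence so is their difference, the
   linear part. *)
have [K LK] : exists K, B^T *m Q *m A = H *m K.
  apply: sub_ker => // w u Hw; have := (HK u).2 w Hw.
  by rewrite lE dotDr -l0 (HK 0).2 // addr0.
have [k0 Lk0] : exists k0, B^T *m b = H *m k0.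
  apply: sub_ker => // w u Hw.
  by rewrite [u]mx11_scalar mul_mx_scalar dotZr -l0 (HK 0).2 // mulr0.
exists (Phi + A^T *m Q *m A + K^T *m H *m K), (A^T *m b + K^T *m (H *m k0)).
exists (c + 1/2 * qform H k0); split.
  by rewrite !linearD /= !trmx_mul !trmxK Ps Qs Hs !mulmxA.
move=> x; pose w0 := K *m x + k0.
have lw : l x = H *m w0 by rewrite lE LK Lk0 mulmxDr mulmxA.
transitivity ((1/2 * qform H w0 + rest x)%:E).
  rewrite -(quad_maxE H w0) -lw -E; apply: esup_max => w.
  by rewrite !E lee_fin lerD2r lw quad_maxE; exact: quad_max.
congr _%:E; rewrite /w0 /rest qform_add // !qformM !qformD dotDl.
by rewrite (dotMl K) (dotMr A x b) (dotC (K^T *m _)); field.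
Qed.

End DynamicProgramming.

(** * Composition of the max-plus kernels *)

Section Kernels.
Variables (R : realType) (n m : nat) (A : 'M[R]_n) (B : 'M[R]_(n, m)).
Variables (Phi M : 'M[R]_n) (gamma : R).
Hypotheses (Phip : posdef Phi) (Mp : posdef M).
Implicit Types (x y z : 'cV[R]_n).

Local Notation S := (Ski A B Phi gamma M).
Local Notation represents := (represents A B Phi gamma M).

Lemma Ski_quad_real i (Theta : nat -> 'M[R]_(n + n)) : (i == 1)%N || (i == 2)%N ->
  controllable A B ->
  (forall k, (0 < k)%N -> represents k i (Theta k)) ->
  forall k z, isquad (fun x => S k i x z).
Proof.
move=> i12 ctr rep k z; elim: k => [|k IH].
  have [N [L [r [Ns _ psiE]]]] := psi_real Mp i12.
  exists (- N), (L *m z), (r z); split; first by rewrite linearN /= Ns.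
  by move=> x; rewrite /Ski /DPk /= psiE qformN (dotC _ x) mulrN mulNr.
apply: DP1_quad => [|//|x0]; first by case: Phip.
apply/eqP => Sy.
have Sall x : S (n + k.+1) i x z = +oo%E.
  rewrite /Ski /DPk iterD; have [u xu] := controllable_steer x x0 ctr.
  have [c] := DPk_reach A B Phi gamma n
    (iter k.+1 (DP1 A B Phi gamma) (psi M i ^~ z)) x u.
  by rewrite -xu iterS Sy addey // leye_eq => /eqP.
have [_ /(_ 0 z)] : represents (n + k.+1) i (Theta (n + k.+1)%N).
  by apply: rep; rewrite addnS.
suff -> : Bki A B Phi gamma M (n + k.+1) i 0 z = +oo%E by [].
rewrite /Bki -[+oo%E]oppeK; congr (- _)%E; apply/eqP; rewrite -leeNy_eq.
by apply: esup_le => x; rewrite Sall addeNy.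
Qed.

Lemma Bki_delta k y z : Bki A B Phi gamma M k 3 y z = S k 3 y z.
Proof. exact: (@conj_delta _ _ M 3 (fun x => S k 3 x z) y). Qed.

Lemma Ski_quad_delta k Theta z : represents k 3 Theta ->
  isquad (fun x => S k 3 x z).
Proof.
move=> [Ts TB]; exists (- ulsubmx Theta), (- (ursubmx Theta *m z)).
exists (- (1/2) * qform (drsubmx Theta) z); split.
  by rewrite linearN /= trmx_ulsub Ts.
move=> x; rewrite -Bki_delta TB qform_col // qformN dotNl (dotC _ x).
by congr _%:E; field.
Qed.

(** Expanding [S p] by [biconj], pushing [DPk] through the supremum and expanding [S k] writes
    [S (k + p)] in the basis with coefficients [F]. A further biconjugation identifies [F] with the
    kernel represented by [Th]. *)
Lemma represents_comp i k p Th1 Th2 Th : let D := drsubmx Th1 + ulsubmx Th2 in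
  represents k i Th1 -> represents p i Th2 -> represents (k + p) i Th ->
  (forall z, isquad (fun x => S k i x z)) ->
  (forall z, isquad (fun x => S p i x z)) ->
  (forall z, isquad (fun x => S (k + p) i x z)) ->
  posdef D ->
  forall v z, qform Th (col_mx v z) =
    qform (ulsubmx Th1) v + qform (drsubmx Th2) z
    - qform (invmx D) ((ursubmx Th1)^T *m v + ursubmx Th2 *m z).
Proof.
move=> D [T1s T1B] [T2s T2B] [Ts TB] q1 q2 q Dp v z.
pose l v := (ursubmx Th1)^T *m v + ursubmx Th2 *m z.
(* [F v] is the supremum over the intermediate variable [y], obtained by completing the square with
   [D]. *)
pose F v := - (1/2) * (qform (ulsubmx Th1) v + qform (drsubmx Th2) z
  - qform (invmx D) (l v)).
have sup_F u : esup (fun y => (- (1/2) * qform Th1 (col_mx u y) +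
    - (1/2) * qform Th2 (col_mx y z))%:E) = (F u)%:E /\
    exists y, F u = - (1/2) * qform Th1 (col_mx u y) +
    - (1/2) * qform Th2 (col_mx y z).
  have E y : - (1/2) * qform Th1 (col_mx u y) + - (1/2) * qform Th2 (col_mx y z)
      = F u - 1/2 * qform D (y + invmx D *m l u).
    have := qform_complete_square (l u) y Dp; rewrite /F [in qform D y]/D qformD.
    rewrite {1}/l dotDr !qform_col // (dotMr _ y u) (dotC _ y); lra.
  have Ey : F u = - (1/2) * qform Th1 (col_mx u (- (invmx D *m l u))) +
      - (1/2) * qform Th2 (col_mx (- (invmx D *m l u)) z).
    by rewrite E addNr qform0; lra.
  split; last by exists (- (invmx D *m l u)).
  rewrite Ey; apply: (@esup_max _ _ _ (- (invmx D *m l u))) => y.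
  rewrite lee_fin -Ey E lerBlDr lerDl.
  have [->|/(Dp.2) /ltW qD] := eqVneq (y + invmx D *m l u) 0.
    by rewrite qform0; lra.
  lra.
have conjS j Th' : represents j i Th' -> (forall z, isquad (fun x => S j i x z)) ->
    forall x z, S j i x z =
      esup (fun y => psi M i x y + (- (1/2) * qform Th' (col_mx y z))%:E)%E.
  move=> [_ TB'] q' x z'.
  have cE y : psi_conj M i (fun x => S j i x z') y
      = (- (1/2) * qform Th' (col_mx y z'))%:E by exact: TB'.
  rewrite (@biconj _ _ _ i Mp _ (q' z')) => [|y]; last by rewrite cE.
  by apply: eq_esup => y; rewrite cE.
have SF x : S (k + p) i x z = (- psi_conj M i (fun u => (- F u)%:E) x)%E.
  rewrite /conj oppeK.
  transitivity (DPk A B Phi gamma k (fun x => esup (fun y =>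
      psi M i x y + (- (1/2) * qform Th2 (col_mx y z))%:E)%E) x).
    rewrite /Ski /DPk iterD; congr (iter k (DP1 A B Phi gamma) _ x); apply: funext => x'.
    exact: (conjS p Th2 (conj T2s T2B) q2).
  rewrite DPk_esup.
  transitivity (esup (fun y => esup (fun u => psi M i x u +
      (- (1/2) * qform Th1 (col_mx u y) +
       - (1/2) * qform Th2 (col_mx y z))%:E)%E)).
    apply: eq_esup => y; rewrite -/(Ski A B Phi gamma M k i x y).
    rewrite (conjS _ _ (conj T1s T1B) q1) -esupDr.
    by apply: eq_esup => u; rewrite EFinD addeA.
  rewrite esup_swap; apply: eq_esup => u; rewrite psiC EFinN oppeK.
  (* The term [psi] may be [-oo], so it is moved past the supremum by means of a point where the
     maximum is attained. *)
  have [sF [y Fy]] := sup_F u.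
  rewrite Fy; apply: (@esup_max _ _ _ y) => y'; apply: leeD2l.
  rewrite -Fy -sF.
  exact: (esup_ub (fun y => (- (1/2) * qform Th1 (col_mx u y) +
    - (1/2) * qform Th2 (col_mx y z))%:E)).
have NFq : isquad (fun u => (- F u)%:E).
  pose b1 := ursubmx Th1; pose b2z := ursubmx Th2 *m z.
  exists (ulsubmx Th1 - b1 *m invmx D *m b1^T), (- (b1 *m (invmx D *m b2z))).
  exists (1/2 * qform (drsubmx Th2) z - 1/2 * qform (invmx D) b2z).
  have Ds := invmx_sym (Dp.1); split.
    rewrite linearB /= !trmx_mul trmxK Ds trmx_ulsub T1s.
    by rewrite mulmxA.
  move=> u; congr _%:E; rewrite /F /l -/b1 -/b2z qform_add // qformM trmxK.
  by rewrite qformD qformN dotNl (dotMl b1^T) trmxK (dotC _ u); field.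
have conjF x : psi_conj M i (fun u => (- F u)%:E) x != -oo%E.
  have [Q [b [c [_ qE]]]] := q z; have := SF x; rewrite qE.
  by case: psi_conj.
have : (- (1/2) * qform Th (col_mx v z))%:E = (F v)%:E.
  (* [SF] is inverted here: [- F] is quadratic and its conjugate is nowhere [-oo], so [S (k + p)]
     determines [F]. *)
  have bF : (- F v)%:E = esup (fun y => psi M i v y +
      psi_conj M i (fun u => (- F u)%:E) y)%E := @biconj _ _ _ i Mp _ NFq conjF v.
  rewrite -TB -[F v]opprK EFinN bF; congr (- _)%E.
  by apply: eq_esup => x; rewrite -/(Ski A B Phi gamma M (k + p) i x z) SF oppeK psiC.
by move=> [] /(congr1 ( *%R (-2))); rewrite /F /l; lra.
Qed.

(** Setting [z = 0], then [v = 0], isolates the diagonal blocks; the remaining cross term gives the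
    off-diagonal one. *)
Lemma represents_blocks i k p Th1 Th2 Th : let D := drsubmx Th1 + ulsubmx Th2 in
  represents k i Th1 -> represents p i Th2 -> represents (k + p) i Th ->
  (forall z, isquad (fun x => S k i x z)) ->
  (forall z, isquad (fun x => S p i x z)) ->
  (forall z, isquad (fun x => S (k + p) i x z)) ->
  posdef D ->
  [/\ forall v, qform (ulsubmx Th) v
        = qform (ulsubmx Th1) v - qform (invmx D) ((ursubmx Th1)^T *m v),
      forall v, qform (drsubmx Th) v
        = qform (drsubmx Th2) v - qform (invmx D) (ursubmx Th2 *m v) &
      ursubmx Th = - (ursubmx Th1 *m invmx D *m ursubmx Th2)].
Proof.
move=> D r1 r2 r q1 q2 q Dp; have Ds := invmx_sym (Dp.1).
have E := represents_comp r1 r2 r q1 q2 q Dp; rewrite -/D in E.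
have Ts := r.1.
have E1 v : qform (ulsubmx Th) v
    = qform (ulsubmx Th1) v - qform (invmx D) ((ursubmx Th1)^T *m v).
  by have := E v 0; rewrite qform_col // !mulmx0 dot0r !qform0 mulr0 !addr0.
have E2 v : qform (drsubmx Th) v
    = qform (drsubmx Th2) v - qform (invmx D) (ursubmx Th2 *m v).
  by have := E 0 v; rewrite qform_col // !mulmx0 dot0l !qform0 mulr0 !add0r.
split=> //; apply: dot_mx_ext => u v; have := E u v.
rewrite qform_col // E1 E2 qform_add // mulNmx dotNr.
rewrite (dotMl _^T) trmxK !mulmxA; lra.
Qed.

End Kernels.

(** * Limits of matrices and of their quadratic forms *)

Section MatrixLimits.
Variable R : realType.
Implicit Types n m p : nat.

Lemma cvg_mx n m (X : nat -> 'M[R]_(n, m)) (L : 'M[R]_(n, m)) :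
  (forall i j, X k i j @[k --> \oo] --> L i j) -> X @ \oo --> L.
Proof.
move=> XL S [P PL PS].
have : \forall k \near \oo, forall i j, P i j (X k i j).
  by do 2![apply: filter_forall => ?]; apply: XL; exact: PL.
by apply: filterS => k; exact: PS.
Qed.

Lemma cvg_sum_seq (I : Type) (r : seq I) (f : I -> nat -> R) (l : I -> R) :
  (forall i, f i @ \oo --> l i) ->
  \sum_(i <- r) f i k @[k --> \oo] --> \sum_(i <- r) l i.
Proof.
move=> fl; elim: r => [|i r IH].
  rewrite big_nil; under eq_fun do rewrite big_nil; exact: cvg_cst.
rewrite big_cons; under eq_fun do rewrite big_cons.
by apply: cvgD => //; exact: fl.
Qed.

Lemma qform_sumE n (Q : 'M[R]_n) v :
  qform Q v = \sum_i \sum_j v i 0 * v j 0 * Q i j.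
Proof.
rewrite qformE dotE; apply: eq_bigr => i _; rewrite mxE mulr_sumr.
by apply: eq_bigr => j _; ring.
Qed.

Lemma cvg_qform n (X : nat -> 'M[R]_n) (L : 'M[R]_n) v :
  (forall i j, X k i j @[k --> \oo] --> L i j) ->
  qform (X k) v @[k --> \oo] --> qform L v.
Proof.
move=> XL; rewrite qform_sumE; under eq_fun do rewrite qform_sumE.
apply: cvg_sum_seq => i; apply: cvg_sum_seq => j.
by apply: cvgM; [exact: cvg_cst|exact: XL].
Qed.

Lemma sym_qformE n (Q : 'M[R]_n) i j : Q^T = Q ->
  Q i j = 1/2 * (qform Q (delta_mx i 0 + delta_mx j 0)
    - qform Q (delta_mx i 0) - qform Q (delta_mx j 0)).
Proof. by move=> Qs; rewrite qform_add // mx_dotE; field. Qed.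

(** By polarisation the entries of a symmetric matrix are combinations of values of its quadratic
    form, and each such value is eventually monotone and bounded. *)
Lemma nonincreasing_qform_cvg n p (X : nat -> 'M[R]_n) (low : 'cV[R]_n -> R) :
  (forall k, (p <= k)%N -> (X k)^T = X k) ->
  (forall k v, (p <= k)%N -> qform (X k.+1) v <= qform (X k) v) ->
  (forall k v, (p <= k)%N -> low v <= qform (X k) v) ->
  exists L : 'M[R]_n, forall i j, X k i j @[k --> \oo] --> L i j.
Proof.
move=> Xs Xd Xl.
have qcv v : cvg (qform (X k) v @[k --> \oo]).
  apply: (@near_nonincreasing_is_cvgn _ _ (low v)); exists p => // k /= pk.
    move=> k' kk'; elim: k' kk' => [|k' IH]; first by rewrite leqn0 => /eqP ->.
    rewrite leq_eqVlt => /predU1P[-> //|]; rewrite ltnS => kk'.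
    by apply: le_trans (IH kk'); apply: Xd; exact: leq_trans pk kk'.
  exact: Xl.
exists (\matrix_(i, j) lim (X k i j @[k --> \oo])) => i j; rewrite mxE.
suff : cvg (X k i j @[k --> \oo]) by [].
have : cvg (1/2 * (qform (X k) (delta_mx i 0 + delta_mx j 0)
    - qform (X k) (delta_mx i 0) - qform (X k) (delta_mx j 0)) @[k --> \oo]).
  apply: is_cvgM; first exact: is_cvg_cst.
  apply: is_cvgB; last exact: qcv.
  by apply: is_cvgB; exact: qcv.
move=> /cvg_ex[l hl]; apply/cvg_ex; exists l; apply: cvg_trans hl.
apply: near_eq_cvg; exists p => // k /= pk.
by rewrite [RHS]sym_qformE // Xs.
Qed.

Lemma contraction_cvg0 p (c : nat -> R) (q : R) : (0 < p)%N ->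
  0 <= q -> q < 1 -> (forall k, 0 <= c k) ->
  (forall k, (p <= k)%N -> c (k + p)%N <= q * c k) -> c @ \oo --> 0.
Proof.
(* [C] dominates [c] on the window from [p] to [2 * p - 1]; the contraction, valid from [p] on,
   carries the bound to later windows. *)
move=> p0 q0 q1 c0 cq; pose C := \sum_(k < 2 * p) c k.
have cC j r : (r < p)%N -> c (j.+1 * p + r)%N <= C * q ^+ j.
  move=> rp; elim: j => [|j IH].
    have lt2 : (1 * p + r < 2 * p)%N by lia.
    rewrite mulr1 /C (bigD1 (Ordinal lt2)) //= lerDl.
    by apply: sumr_ge0 => i _; exact: c0.
  have -> : (j.+2 * p + r = j.+1 * p + r + p)%N by lia.
  apply: le_trans (cq _ _) _; first lia.
  by rewrite exprS mulrCA; apply: ler_wpM2l.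
have /cvgrPdist_lt Cq0 : geometric C q @ \oo --> 0.
  by apply: cvg_geometric; rewrite ger0_norm.
apply/cvgrPdist_lt => e /Cq0 [N _ hN]; exists (N.+1 * p)%N => // k /= Nk.
rewrite sub0r normrN ger0_norm //.
have [j [r [rp kE Nj]]] : exists j r, [/\ (r < p)%N, k = (j.+1 * p + r)%N & (N <= j)%N].
  exists (k %/ p).-1, (k %% p)%N; rewrite ltn_mod p0.
  have kp : (N.+1 <= k %/ p)%N by rewrite leq_divRL.
  split => //; last lia.
  by rewrite prednK ?(leq_trans _ kp) // -divn_eq.
rewrite kE; apply: le_lt_trans (cC _ _ rp) _; have := hN j Nj.
by rewrite /= sub0r normrN; apply: le_lt_trans; exact: ler_norm.
Qed.

(* Both diagonal blocks decrease as quadratic forms; each is bounded below since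
   their sum is and the other one is bounded above. *)
Lemma blockdiag_criterion n p (rho : R) (Theta : nat -> 'M[R]_(n + n)) :
  (forall k, (p <= k)%N -> (Theta k)^T = Theta k) ->
  (forall k v, (p <= k)%N ->
    qform (ulsubmx (Theta k.+1)) v <= qform (ulsubmx (Theta k)) v) ->
  (forall k v, (p <= k)%N ->
    qform (drsubmx (Theta k.+1)) v <= qform (drsubmx (Theta k)) v) ->
  (forall k, (p <= k)%N ->
    mxle rho%:M (ulsubmx (Theta k) + drsubmx (Theta k))) ->
  (forall v, dot ((ursubmx (Theta k))^T *m v) ((ursubmx (Theta k))^T *m v)
     @[k --> \oo] --> (0 : R)) ->
  conv_blockdiag rho Theta.
Proof.
move=> Ts ad dd low b0.
have dec (X : nat -> 'M[R]_n) v : (forall k v, (p <= k)%N ->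
    qform (X k.+1) v <= qform (X k) v) ->
    forall k, (p <= k)%N -> qform (X k) v <= qform (X p) v.
  move=> Xd; elim=> [|k IH]; first by rewrite leqn0 => /eqP ->.
  rewrite leq_eqVlt => /predU1P[<- //|]; rewrite ltnS => pk.
  exact: le_trans (Xd _ _ pk) (IH pk).
have [a al] : exists L : 'M[R]_n, forall i j,
    ulsubmx (Theta k) i j @[k --> \oo] --> L i j.
  apply: (@nonincreasing_qform_cvg _ p _
    (fun v => qform rho%:M v - qform (drsubmx (Theta p)) v)) => // k.
    by move=> pk; rewrite trmx_ulsub Ts.
  move=> v pk; have := low k pk v; have := dec _ v dd k pk; rewrite qformD; lra.
have [d dl] : exists L : 'M[R]_n, forall i j,
    drsubmx (Theta k) i j @[k --> \oo] --> L i j.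
  apply: (@nonincreasing_qform_cvg _ p _
    (fun v => qform rho%:M v - qform (ulsubmx (Theta p)) v)) => // k.
    by move=> pk; rewrite trmx_drsub Ts.
  move=> v pk; have := low k pk v; have := dec _ v ad k pk; rewrite qformD; lra.
(* The transposed block sends the [i]-th unit vector to row [i], so each entry is at most the norm
   controlled by [b0]. *)
have bl i j : ursubmx (Theta k) i j @[k --> \oo] --> (0 : R).
  apply/cvgrPdist_lt => e e0.
  have e20 : 0 < e ^+ 2 by exact: exprn_gt0.
  move/cvgrPdist_lt : (b0 (delta_mx i 0)) => /(_ _ e20); apply: filterS => k.
  rewrite !sub0r !normrN => he; rewrite -(@ltr_pXn2r _ 2) ?nnegrE ?normr_ge0 ?(ltW e0) //.
  apply: le_lt_trans he; rewrite [leRHS]ger0_norm ?dot_ge0 // dotE (bigD1 j) //=.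
  rewrite -colE !mxE -normrX ger0_norm ?sqr_ge0 // expr2 lerDl.
  by apply: sumr_ge0 => l _; rewrite -expr2 sqr_ge0.
exists (block_mx a 0 0 d); split.
- apply: cvg_mx => i j.
  case: (split_ordP i) => i' ->; case: (split_ordP j) => j' ->.
  + by rewrite block_mxEul; have := al i' j'; under eq_fun do rewrite !mxE.
  + by rewrite block_mxEur mxE; have := bl i' j'; under eq_fun do rewrite !mxE.
  + rewrite block_mxEdl mxE; apply: cvg_trans (bl j' i'); apply: near_eq_cvg.
    by exists p => // k /= pk; rewrite -[in RHS]Ts // !mxE.
  + by rewrite block_mxEdr; have := dl i' j'; under eq_fun do rewrite !mxE.
- by rewrite block_mxKur.
- by rewrite block_mxKdl.
move=> v; rewrite block_mxKul block_mxKdr.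
have sl : qform (ulsubmx (Theta k) + drsubmx (Theta k)) v @[k --> \oo]
    --> qform (a + d) v.
  apply: (@cvg_qform _ (fun k => ulsubmx (Theta k) + drsubmx (Theta k))) => i j.
  rewrite mxE; under eq_fun do rewrite mxE.
  by apply: cvgD; [exact: al|exact: dl].
by apply: (cvgr_to_ge sl); exists p => // k /= pk; exact: low.
Qed.

End MatrixLimits.

(** * Contraction estimates for the block recursion *)

Section Recursion.
Variables (R : realType) (n p : nat) (Theta : nat -> 'M[R]_(n + n)).
Variables (sigma lambda rho : R).
Hypotheses (p_gt0 : (0 < p)%N) (sigma0 : 0 < sigma) (rho0 : 0 < rho).
Hypothesis q1 : rho ^- 2 * sigma < 1.
Hypothesis rho_le : rho <= lambda - 2 * rho^-1 * sigma * (1 - rho ^- 2 * sigma)^-1.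
Hypothesis Theta_sym : forall k, (p <= k)%N -> (Theta k)^T = Theta k.
Hypothesis hyps : block_hyps sigma lambda (Theta p).

Local Notation a k := (ulsubmx (Theta k)).
Local Notation b k := (ursubmx (Theta k)).
Local Notation d k := (drsubmx (Theta k)).
Local Notation D k := (d k + a p).
Local Notation normb k v := (dot ((b k)^T *m v) ((b k)^T *m v)).

Hypothesis step : forall k, (p <= k)%N -> posdef (D k) ->
  [/\ forall v, qform (a (k + p)) v = qform (a k) v - qform (invmx (D k)) ((b k)^T *m v),
      forall v, qform (d (k + p)) v = qform (d p) v - qform (invmx (D k)) (b p *m v) &
      b (k + p) = - (b k *m invmx (D k) *m b p)].

(** [q] is the contraction factor of the squared off-diagonal block, [s] bounds the loss of either
    diagonal block in the first step, and [T] is the geometric series [s + q s + q ^ 2 s + ...]. *)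
Let q := rho ^- 2 * sigma.
Let s := rho^-1 * sigma.
Let T := s * (1 - q)^-1.

Let q0 : 0 <= q. Proof. by rewrite mulr_ge0 ?invr_ge0 ?exprn_ge0 ?ltW. Qed.

Let T1q : T * (1 - q) = s.
Proof. by rewrite mulfVK // lt0r_neq0 // subr_gt0. Qed.

Let s_ge0 : 0 <= s. Proof. by rewrite mulr_ge0 ?invr_ge0 ?ltW. Qed.

Let s_le_T : s <= T.
Proof.
have T0 : 0 <= T by rewrite mulr_ge0 // invr_ge0 subr_ge0 ltW.
by rewrite -T1q mulrBr mulr1 lerBlDr lerDl mulr_ge0.
Qed.

(** One [T] pays for the total loss of the (1,1) block; the other, through [s_le_T], for that of the
    (2,2) block. *)
Let rho_le' : rho <= lambda - 2 * T.
Proof. by move: rho_le; rewrite /T /s !mulrA. Qed.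

Let rhos : rho * s = sigma.
Proof. by rewrite /s mulrA divff ?mul1r // gt_eqF. Qed.

Definition Dge k := forall v, rho * dot v v <= qform (D k) v.

Let D_sym k : (p <= k)%N -> (D k)^T = D k.
Proof.
by move=> pk; rewrite linearD /= trmx_drsub trmx_ulsub !Theta_sym.
Qed.

Let D_posdef k : (p <= k)%N -> Dge k -> posdef (D k).
Proof. by move=> pk; apply: posdef_ge => //; exact: D_sym. Qed.

Let bl : dlsubmx (Theta p) = (b p)^T.
Proof. by rewrite trmx_ursub Theta_sym. Qed.

Let normb_le v : normb p v <= sigma * dot v v.
Proof.
by case: hyps => /(_ v) + _ _; rewrite bl qform_scalar qformE -mulmxA dotMr.
Qed.

Let normbT_le v : dot (b p *m v) (b p *m v) <= sigma * dot v v.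
Proof.
by case: hyps => _ /(_ v) + _; rewrite bl qform_scalar qformE -mulmxA dotMr trmxK.
Qed.

Let inv_le k v : (p <= k)%N -> Dge k ->
  rho * qform (invmx (D k)) v <= dot v v /\
  rho ^+ 2 * dot (invmx (D k) *m v) (invmx (D k) *m v) <= dot v v.
Proof. by move=> pk Dk; apply: qform_inv_le => //; exact: D_sym. Qed.

Let lambda_le v : lambda * dot v v <= qform (a p) v + qform (d p) v.
Proof. by case: hyps => _ _ /(_ v); rewrite qform_scalar qformD. Qed.

(** The (2,2) block at [k + p] comes from the one at [p] by a single subtraction, so its loss does
    not accumulate with [k]. *)
Lemma d_ge k v : (p <= k)%N -> Dge k ->
  qform (d p) v - s * dot v v <= qform (d (k + p)) v.
Proof.
move=> pk Dk; have [_ -> _] := step pk (D_posdef pk Dk).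
have [h _] := inv_le (b p *m v) pk Dk; have := normbT_le v.
by rewrite -rhos => h2; rewrite lerD2l lerN2 -(ler_pM2l rho0); lra.
Qed.

Lemma Dge_base : Dge p.
Proof.
move=> v; rewrite qformD addrC; apply: le_trans (lambda_le v).
apply: ler_wpM2r; first exact: dot_ge0.
by move: rho_le' s_ge0 s_le_T; lra.
Qed.

Lemma Dge_step k : (p <= k)%N -> Dge k -> Dge (k + p).
Proof.
move=> pk Dk v; have := d_ge v pk Dk; have := lambda_le v.
rewrite qformD => h1 h2; have := dot_ge0 v.
have : (rho - lambda + s) * dot v v <= 0.
  apply: mulr_le0_ge0; last exact: dot_ge0.
  by move: rho_le' s_ge0 s_le_T; lra.
lra.
Qed.

(** In the new block, [invmx (D k)] contributes [rho ^- 2] and [b p] contributes [sigma] to the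
    squared norm. *)
Lemma normb_step k v : (p <= k)%N -> Dge k -> normb (k + p) v <= q * normb k v.
Proof.
move=> pk Dk; have Ds := invmx_sym (D_sym pk).
have [_ _ ->] := step pk (D_posdef pk Dk).
rewrite linearN /= !trmx_mul Ds !mulNmx dotNl dotNr opprK -!mulmxA.
set u := _ *m v; apply: le_trans (normb_le _) _.
have [_ h] := inv_le u pk Dk.
rewrite -(ler_pM2l (exprn_gt0 2 rho0)) mulrCA /q !mulrA divff; last first.
  by rewrite gt_eqF // exprn_gt0.
by rewrite mul1r -!mulrA ler_pM2l // mulrA -expr2.
Qed.

Lemma a_ge k v : (p <= k)%N -> Dge k ->
  rho * (qform (a k) v - qform (a (k + p)) v) <= normb k v.
Proof.
move=> pk Dk; have [-> _ _] := step pk (D_posdef pk Dk).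
have [h _] := inv_le ((b k)^T *m v) pk Dk.
by rewrite opprB addrC subrK.
Qed.

(** The bounds are proved together because positivity of [D] makes the recursion applicable. Step
    [j] loses at most [q ^+ j * s], and [T * (1 - q ^+ j)] is the partial sum of these losses. *)
Lemma multiples j : [/\ Dge (j.+1 * p),
  forall v, normb (j.+1 * p) v <= q ^+ j * (sigma * dot v v) &
  forall v, qform (a p) v - T * (1 - q ^+ j) * dot v v <= qform (a (j.+1 * p)) v].
Proof.
elim: j => [|j [IH1 IH2 IH3]].
  rewrite mul1n; split; first exact: Dge_base.
    by move=> v; rewrite expr0 mul1r.
  by move=> v; rewrite expr0 subrr mulr0 mul0r subr0.
have pj : (p <= j.+1 * p)%N by rewrite leq_pmull.
rewrite (mulSn j.+1) addnC; split; first exact: Dge_step.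
  move=> v; apply: le_trans (normb_step _ pj IH1) _.
  by rewrite exprS -mulrA; apply: ler_wpM2l.
move=> v; have h := le_trans (a_ge v pj IH1) (IH2 v); have := IH3 v.
move: h; rewrite -rhos -(mulrA rho) mulrCA ler_pM2l // exprS => h h'.
have e : T * (1 - q * q ^+ j) = T * (1 - q ^+ j) + q ^+ j * s.
  by rewrite -T1q; ring.
by rewrite e mulrDl -mulrA; lra.
Qed.

Lemma sum_multiples j v :
  rho * dot v v <= qform (a (j.+1 * p)) v + qform (d (j.+1 * p)) v.
Proof.
have v0 := dot_ge0 v; have := lambda_le v.
have T0 : 0 <= T := le_trans s_ge0 s_le_T.
have [_ _ /(_ v) ha] := multiples j.
have hd : qform (d p) v - s * dot v v <= qform (d (j.+1 * p)) v.
  case: j {ha} => [|j]; first by rewrite mul1n lerBlDr lerDl mulr_ge0.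
  rewrite (mulSn j.+1) addnC; apply: d_ge; first by rewrite leq_pmull.
  by have [] := multiples j.
have hT : T * (1 - q ^+ j) * dot v v <= T * dot v v.
  apply: ler_wpM2r => //; rewrite ler_piMr // lerBlDr lerDl.
  exact: exprn_ge0.
have : (rho - lambda + T + s) * dot v v <= 0.
  by apply: mulr_le0_ge0 => //; move: rho_le' s_ge0 s_le_T; lra.
lra.
Qed.

Hypothesis a_dec : forall k v, (p <= k)%N -> qform (a k.+1) v <= qform (a k) v.
Hypothesis d_dec : forall k v, (p <= k)%N -> qform (d k.+1) v <= qform (d k) v.

(** [k.+1 * p] is a multiple of [p] not below [k], so lower bounds known at multiples pass to every
    index. *)
Lemma dec_ge (X : nat -> 'M[R]_n) :
  (forall k v, (p <= k)%N -> qform (X k.+1) v <= qform (X k) v) ->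
  forall k v, (p <= k)%N -> qform (X (k.+1 * p)%N) v <= qform (X k) v.
Proof.
move=> Xd k v pk; have : (k <= k.+1 * p)%N.
  by apply: leq_trans (leqnSn k) _; rewrite leq_pmulr.
elim: (k.+1 * p)%N => [|k' IH]; first by rewrite leqn0 => /eqP ->.
rewrite leq_eqVlt => /predU1P[<- //|]; rewrite ltnS => kk'.
by apply: le_trans (IH kk'); apply: Xd; exact: leq_trans pk kk'.
Qed.

Lemma conv_of_decreasing : conv_blockdiag rho Theta.
Proof.
(* With [Dge] at every index from [p] on, [normb_step] acts on each residue class modulo [p]. *)
have Dk k : (p <= k)%N -> Dge k.
  move=> pk v; have [/(_ v) + _ _] := multiples k; rewrite !qformD.
  by have := dec_ge d_dec v pk; lra.
apply: (@blockdiag_criterion _ _ p) => // [k pk v|v].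
  rewrite qform_scalar qformD; have := sum_multiples k v.
  by have := dec_ge d_dec v pk; have := dec_ge a_dec v pk; lra.
apply: (@contraction_cvg0 _ p _ q) => // k; first exact: dot_ge0.
by move=> pk; apply: normb_step => //; exact: Dk.
Qed.

End Recursion.

(* For [p = 1] the Riccati recursion of the [D k] is monotone, hence decreasing
   since it decreases at the first step. *)
Lemma conv_of_step1 (R : realType) n (Theta : nat -> 'M[R]_(n + n))
  (sigma lambda rho : R) : 0 < sigma -> 0 < rho -> rho ^- 2 * sigma < 1 ->
  rho <= lambda - 2 * rho^-1 * sigma * (1 - rho ^- 2 * sigma)^-1 ->
  (forall k, (1 <= k)%N -> (Theta k)^T = Theta k) ->
  block_hyps sigma lambda (Theta 1%N) ->
  (forall k, let D := drsubmx (Theta k) + ulsubmx (Theta 1%N) in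
    (1 <= k)%N -> posdef D ->
    [/\ forall v, qform (ulsubmx (Theta (k + 1)%N)) v
          = qform (ulsubmx (Theta k)) v - qform (invmx D) ((ursubmx (Theta k))^T *m v),
        forall v, qform (drsubmx (Theta (k + 1)%N)) v
          = qform (drsubmx (Theta 1%N)) v - qform (invmx D) (ursubmx (Theta 1%N) *m v) &
        ursubmx (Theta (k + 1)%N)
          = - (ursubmx (Theta k) *m invmx D *m ursubmx (Theta 1%N))]) ->
  conv_blockdiag rho Theta.
Proof.
move=> s0 r0 q1 rl Ts hyps step.
have Dp k : (1 <= k)%N -> posdef (drsubmx (Theta k) + ulsubmx (Theta 1%N)).
  case: k => // k _.
  (* With stride 1 the multiples are all the positive indices. *)
  have [+ _ _] := @multiples _ _ 1%N _ _ _ _ s0 r0 q1 rl Ts hyps step k.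
  rewrite muln1; apply: posdef_ge => //.
  by rewrite linearD /= trmx_drsub trmx_ulsub !Ts.
have step' k : (1 <= k)%N -> _ := fun k1 => step k k1 (Dp k k1).
apply: (@conv_of_decreasing _ _ 1%N _ _ _ _ isT s0 r0 q1 rl Ts hyps step).
  move=> k v k1; rewrite -addn1; have [-> _ _] := step' k k1.
  by rewrite lerBlDr lerDl; apply: qform_inv_ge0; exact: Dp.
move=> k v; elim: k v => // -[_ v _|k IH v _].
  rewrite -[2%N]/(1 + 1)%N; have [_ -> _] := step' 1%N isT.
  by rewrite lerBlDr lerDl; apply: qform_inv_ge0; exact: Dp.
rewrite -[in leLHS](addn1 k.+2); have [_ -> _] := step' k.+2 isT.
rewrite -[in leRHS](addn1 k.+1); have [_ -> _] := step' k.+1 isT.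
rewrite lerD2l lerN2; apply: qform_inv_anti; [exact: Dp|exact: Dp|].
by move=> u; rewrite !qformD lerD2r; exact: IH.
Qed.

(** * Decrease of the diagonal blocks for the delta basis *)

Section DeltaKernel.
Variables (R : realType) (n m : nat) (A : 'M[R]_n) (B : 'M[R]_(n, m)).
Variables (Phi M : 'M[R]_n) (gamma : R).
Local Notation represents := (represents A B Phi gamma M).

(* One more step at the origin, taken first or last, costs nothing. *)
Lemma represents_delta_dec k Th Th' : represents k 3 Th -> represents k.+1 3 Th' ->
  (forall v, qform (ulsubmx Th') v <= qform (ulsubmx Th) v) /\
  (forall v, qform (drsubmx Th') v <= qform (drsubmx Th) v).
Proof.
move=> [Ts TB] [Ts' TB']; split=> v.
  have : (Bki A B Phi gamma M k 3 v 0 <= Bki A B Phi gamma M k.+1 3 v 0)%E.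
    (* For the (1,1) block the path ends at the origin, so the extra step is the last in time;
       [iterSr] places it innermost. *)
    rewrite !Bki_delta /Ski /DPk iterSr; apply: DPk_mono => x.
    rewrite /psi /=; have [->|_] := eqVneq x 0; last exact: leNye.
    have := DP1_ge_rest A B Phi gamma
      (fun x => if x == 0%R then 0%E else -oo%E).
    by rewrite eqxx.
  by rewrite TB TB' lee_fin !qform_col // !mulmx0 dot0r !qform0; lra.
have : (Bki A B Phi gamma M k 3 0 v <= Bki A B Phi gamma M k.+1 3 0 v)%E.
  by rewrite !Bki_delta; exact: DP1_ge_rest.
by rewrite TB TB' lee_fin !qform_col // !dot0l !qform0; lra.
Qed.

End DeltaKernel.

Theorem theorem4p4 (R : realType) (n m : nat)
  (A : 'M[R]_n) (B : 'M[R]_(n, m)) (Phi M : 'M[R]_n) (gamma sigma lambda rho : R) :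
  controllable A B -> \rank B = m -> (m <= n)%N ->
  posdef Phi -> posdef M ->
  0 < sigma -> 0 < lambda -> 0 < rho ->
  rho ^- 2 * sigma < 1 ->
  rho <= lambda - 2 * rho^-1 * sigma * (1 - rho ^- 2 * sigma)^-1 ->
  (* (1) *)
  (forall (i : nat) (Theta : nat -> 'M[R]_(n + n)),
     (1 <= i <= 3)%N ->
     (forall k : nat, (1 <= k)%N -> represents A B Phi gamma M k i (Theta k)) ->
     block_hyps sigma lambda (Theta 1%N) ->
     conv_blockdiag rho Theta)
  /\
  (* (2) *)
  ((m < n)%N ->
   forall Theta : nat -> 'M[R]_(n + n),
     (forall k : nat, (n <= k)%N -> represents A B Phi gamma M k 3 (Theta k)) ->
     block_hyps sigma lambda (Theta n) ->
     conv_blockdiag rho Theta).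
Proof.
move=> ctr _ _ Phip Mp s0 _ r0 q1 rl; split=> [i Theta i13 rep hyps|mn Theta rep hyps].
  have quad k z : (1 <= k)%N -> isquad (fun x => Ski A B Phi gamma M k i x z).
    move=> k1; have [i12|i3] := boolP ((i == 1%N) || (i == 2%N)).
      exact: (Ski_quad_real Phip Mp i12 ctr rep).
    have i_eq3 : i = 3%N by lia.
    by have := rep k k1; rewrite i_eq3; exact: Ski_quad_delta.
  apply: (conv_of_step1 s0 r0 q1 rl) => // [k k1|k D k1 Dp].
    by case: (rep k k1).
  have k1' : (1 <= k + 1)%N by rewrite addn1.
  by apply: (represents_blocks Mp (rep k k1) (rep 1%N isT) (rep _ k1')) Dp => z;
    exact: quad.
have n0 : (0 < n)%N by exact: leq_ltn_trans mn.
have quad k z (nk : (n <= k)%N) := Ski_quad_delta z (rep k nk).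
(* The recursion has stride [n] here, so consecutive indices are compared by resting at the
   origin. *)
have dec k (nk : (n <= k)%N) := represents_delta_dec (rep k nk) (rep k.+1 (leqW nk)).
apply: (@conv_of_decreasing _ _ n _ _ _ _ n0 s0 r0 q1 rl) => //
  [k nk|k nk Dp|k v nk|k v nk].
- by case: (rep k nk).
- have nkn : (n <= k + n)%N by rewrite leq_addl.
  by apply: (represents_blocks Mp (rep k nk) (rep n (leqnn n)) (rep _ nkn)) Dp => z;
    exact: quad.
- exact: (dec k nk).1.
- exact: (dec k nk).2.
Qed.
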